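(* Let $A=(A,\oplus,\odot)$ be a minimal finite skew brace such that the additive group $A_{\oplus}$ is solvable and the multiplicative group $A_{\odot}$ is not solvable; that is, $A$ is a finite skew brace with $A_{\oplus}$ solvable and $A_{\odot}$ not solvable, and no proper skew subbrace $B$ of $A$ has $B_{\oplus}$ solvable and $B_{\odot}$ not solvable. Then the group $A_{\odot}$ is not simple.
   Context: A skew brace $A=(A,\oplus,\odot)$ is a set $A$ with two binary operations $\oplus,\odot$ such that $A_{\oplus}=(A,\oplus)$ and $A_{\odot}=(A,\odot)$ are groups (neither assumed abelian) and $a\odot(b\oplus c)=(a\odot b)\ominus a\oplus(a\odot c)$ for all $a,b,c\in A$, where $\ominus a$ denotes the inverse of $a$ with respect to $\oplus$. The group $A_{\oplus}$ is called the additive group of $A$ and $A_{\odot}$ the multiplicative group of $A$. A skew subbrace of $A$ is a subset $B\subseteq A$ that is a subgroup of both $A_{\oplus}$ and $A_{\odot}$ (hence is itself a skew brace under the restricted operations); it is proper if $B\neq A$. *)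

(* Defs.v *)
From HB Require Import structures.
From mathcomp Require Import all_boot all_fingroup all_solvable.

Set Implicit Arguments.
Unset Strict Implicit.
Unset Printing Implicit Defensive.

(* Neutral elements and inverses are recorded as data; they are determined by  *)
(* the two operations, so this agrees with a pair of binary operations each of *)
(* which is a group law.                                                       *)
Record skew_brace (T : Type) := SkewBrace {
  sb_add  : T -> T -> T;
  sb_zero : T;
  sb_opp  : T -> T;
  sb_mul  : T -> T -> T;
  sb_one  : T;
  sb_inv  : T -> T;
  sb_addA : associative sb_add;
  sb_add0 : left_id sb_zero sb_add;
  sb_addN : left_inverse sb_zero sb_opp sb_add;
  sb_mulA : associative sb_mul;
  sb_mul1 : left_id sb_one sb_mul;
  sb_mulV : left_inverse sb_one sb_inv sb_mul;
  (* a . (b + c) = (a . b) - a + (a . c) *)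
  sb_brace : forall a b c,
    sb_mul a (sb_add b c) =
    sb_add (sb_add (sb_mul a b) (sb_opp a)) (sb_mul a c)
}.

(* Aliases of the carrier T, so that the two group structures of A do not      *)
(* compete for canonical inference. MathComp writes both groups                *)
(* multiplicatively: in addG A, x * y is the sum of x and y.                   *)
Definition addG (T : finType) (A : skew_brace T) : Type := T.
Definition mulG (T : finType) (A : skew_brace T) : Type := T.

HB.instance Definition _ (T : finType) (A : skew_brace T) :=
  Finite.copy (addG A) T.
HB.instance Definition _ (T : finType) (A : skew_brace T) :=
  Finite_isGroup.Build (addG A) (sb_addA A) (sb_add0 A) (sb_addN A).

HB.instance Definition _ (T : finType) (A : skew_brace T) :=
  Finite.copy (mulG A) T.
HB.instance Definition _ (T : finType) (A : skew_brace T) :=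
  Finite_isGroup.Build (mulG A) (sb_mulA A) (sb_mul1 A) (sb_mulV A).

(* The finType structures of T, addG A and mulG A have the same elements but   *)
(* are not convertible when T is a variable, hence the explicit transfers.     *)
Definition add_set (T : finType) (A : skew_brace T) (B : {set T}) :
  {set addG A} := [set x : addG A | (x : T) \in B].
Definition mul_set (T : finType) (A : skew_brace T) (B : {set T}) :
  {set mulG A} := [set x : mulG A | (x : T) \in B].

Definition skew_subbrace (T : finType) (A : skew_brace T) (B : {set T}) : bool :=
  group_set (add_set A B) && group_set (mul_set A B).

(* Solvability of the groups of a subbrace B is solvability of B as a subgroup *)
(* of the corresponding group of A.                                            *)
Definition add_solvable_mul_nonsolvable
    (T : finType) (A : skew_brace T) (B : {set T}) : bool :=
  solvable (add_set A B) && ~~ solvable (mul_set A B).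

Definition minimal_add_solvable_mul_nonsolvable
    (T : finType) (A : skew_brace T) : Prop :=
  [/\ solvable [set: addG A], ~~ solvable [set: mulG A] &
    forall B : {set T}, skew_subbrace A B -> B != [set: T] ->
      ~~ add_solvable_mul_nonsolvable A B].

(* Main.v *)
Require Import Defs.
From mathcomp Require Import all_boot all_fingroup all_solvable.
From mathcomp Require Import all_algebra all_character.
From mathcomp Require Import zify ring.

(* In the symmetric group of A let N be the group of additive translations, H *)
(* that of multiplicative translations, and G the image of the action lambda  *)
(* of the multiplicative group on the additive one. Then X = NG = HG. If the  *)
(* multiplicative group is simple and not solvable, X is perfect, being       *)
(* generated by the perfect groups G and H; and X = N ><| G where G is simple *)
(* and |N| = |G|.                                                             *)
(*   Every prime r dividing |N| then occurs in a noncentral chief factor r^n  *)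
(* of X inside N: otherwise N would have a nontrivial r-quotient that is      *)
(* central modulo its kernel and hence, G being a complement of N, a quotient *)
(* of the perfect group X. On that factor G acts faithfully, so |G| divides   *)
(* |GL_n(r)|. By Burnside's p^a q^b theorem, |G| = |N| has two odd prime      *)
(* divisors p and q; with their chief factors p^n and q^m, q^m divides        *)
(* |GL_n(p)| and p^n divides |GL_m(q)|. But an odd prime power q^m dividing   *)
(* |GL_n(p)|, with p odd and distinct from q, is less than p^n, whence        *)
(* q^m < p^n < q^m.                                                           *)

Set Implicit Arguments.
Unset Strict Implicit.
Unset Printing Implicit Defensive.

(** In this argument [perfect_sdprod_dvd_GL] gives the divisibility into |GL_n(r)| and
    [prime_power_dvd_GL_lt] the bound on prime powers; [perfect_sdprod_card_neq] plays them against
    each other, and [mulG_not_simple] builds X. If lambda is not faithful, it is trivial by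
    simplicity; then X = N is perfect and solvable, hence trivial, which is absurd. *)

(** * Odd prime parts of factorials and of products of [x ^ i - 1] *)

Lemma logn_ndvd q n : ~~ (q %| n) -> logn q n = 0.
Proof. by rewrite lognE => /negPf->; rewrite !andbF. Qed.

(** First-order expansions in [q]. They are proved together because the remainder of the sum
    accumulates those of the powers. *)
Lemma geometric_sum_mod_sqr q t k :
  exists c d, (1 + t * q) ^ k = 1 + k * t * q + q ^ 2 * c /\
    \sum_(i < k) (1 + t * q) ^ i = k + t * q * 'C(k, 2) + q ^ 2 * d.
Proof.
elim: k => [|k [c [d [IHz IHs]]]].
  by exists 0, 0; rewrite big_ord0 bin0n; lia.
exists (c * (1 + t * q) + k * t ^ 2), (d + c).
rewrite big_ord_recr /= expnS IHs IHz binS bin1; split; ring.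
Qed.

(** Lifting the exponent. The cofactor of [y - 1] is a sum of powers congruent to [j] mod [q], a
    unit if [q] does not divide [j]. For [j = i * q], the cofactor of [y ^ i - 1] is congruent to
    [q] mod [q ^ 2], so exactly one factor [q] is gained over [i]. *)
Lemma logn_exp_sub1 q y j :
    prime q -> odd q -> 1 < y -> y = 1 %[mod q] -> 0 < j ->
  logn q (y ^ j - 1) = logn q (y - 1) + logn q j.
Proof.
move=> q_pr q_odd y_gt1 y1; have q_gt0 := prime_gt0 q_pr.
have [m] := ubnP j; elim: m j => // m IHm j ltjm j_gt0.
have [/dvdnP[i def_j] | q'j] := boolP (q %| j); last first.
  have sum_j : \sum_(i < j) y ^ i = j %[mod q].
    rewrite -modn_summ (eq_bigr (fun=> 1 %% q)) => [|i _].
      by rewrite modn_summ sum1_card card_ord.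
    by rewrite -modnXm y1 modnXm exp1n.
  have nz : ~~ (q %| \sum_(i < j) y ^ i) by rewrite /dvdn sum_j.
  have sum_gt0 : 0 < \sum_(i < j) y ^ i.
    by rewrite lt0n; apply: contra nz => /eqP->.
  rewrite subn1 predn_exp -subn1 lognM ?subn_gt0 // (logn_ndvd nz).
  by rewrite [logn q j]logn_ndvd.
have i_gt0 : 0 < i by lia.
have ltij : i < j by rewrite def_j ltn_Pmulr ?prime_gt1.
have z1 : y ^ i = 1 %[mod q] by rewrite -modnXm y1 modnXm exp1n.
have z_gt1 : 1 < y ^ i by rewrite -[1](exp1n i) ltn_exp2r.
have /dvdnP[t def_t] : q %| y ^ i - 1 by rewrite -eqn_mod_dvd ?z1 // ltnW.
have def_z : y ^ i = (1 + t * q) by lia.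
have [_ [d [_ sum_z]]] := geometric_sum_mod_sqr q t q.
(* As [q] is odd, this makes the term [t * q * 'C(q, 2)] vanish mod [q ^ 2]. *)
have /dvdnP[b def_b] : q %| 'C(q, 2).
  apply: prime_dvd_bin => //; have := prime_gt1 q_pr.
  by case: (ltngtP 2 q) => // q2; rewrite -q2 in q_odd.
rewrite {1}def_j expnM subn1 predn_exp.
have -> : \sum_(l < q) (y ^ i) ^ l = q * (1 + q * (t * b + d)).
  by rewrite def_z sum_z def_b; nia.
rewrite !lognM // -?subn1; try lia.
rewrite IHm; try lia.
rewrite (logn_prime _ q_pr) eqxx [logn q (1 + _)]logn_ndvd.
  by rewrite def_j lognM // (logn_prime _ q_pr) eqxx; lia.
by rewrite /dvdn addnC mulnC modnMDl modn_small // prime_gt1.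
Qed.

(** Legendre's formula, one step: the multiples of [q] up to [n] are [q] times 1, ..., [n %/ q]. *)
Lemma logn_fact_rec q n : prime q ->
  logn q n`! = n %/ q + logn q (n %/ q)`!.
Proof.
move=> q_pr; elim: n => [|n IHn]; first by rewrite div0n.
rewrite factS lognM ?fact_gt0 // IHn divnS ?prime_gt0 //.
have [/dvdnP[j def_n] | q'n] := boolP (q %| n.+1); last first.
  by rewrite [logn q n.+1]logn_ndvd.
have nq : n %/ q = j.-1.
  have := divnS n (prime_gt0 q_pr).
  by rewrite def_n mulnK ?prime_gt0 // dvdn_mull // => ->.
rewrite nq def_n.
case: j => [|j] in def_n nq *; first by [].
rewrite /= add1n factS !lognM ?fact_gt0 ?(prime_gt0 q_pr) //.
by rewrite (logn_prime _ q_pr) eqxx; lia.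
Qed.

(** By Legendre's recursion and induction the left side is at most (2q)^(n/q), and 2q <= 2^q for q
    >= 3. *)
Lemma part_fact_le_exp2 q n : prime q -> odd q -> q ^ logn q n`! <= 2 ^ n.
Proof.
move=> q_pr q_odd; have q_gt2 : 2 < q by rewrite odd_prime_gt2.
have [m] := ubnP n; elim: m n => // m IHm n ltnm.
case: (posnP n) => [-> | n_gt0]; first by rewrite logn1.
rewrite logn_fact_rec // expnD.
have ltn := ltn_Pdiv (prime_gt1 q_pr) n_gt0.
have {}IHm : q ^ logn q (n %/ q)`! <= 2 ^ (n %/ q) by apply: IHm; lia.
apply: leq_trans (leq_mul (leqnn _) IHm) _.
have q2 : q * 2 <= 2 ^ q.
  case: q q_gt2 {q_pr q_odd IHm ltn} => [|[|[|q]]] // _.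
  elim: q => // q; rewrite (expnS 2 q.+3); lia.
rewrite -expnMn; apply: leq_trans (_ : (2 ^ q) ^ (n %/ q) <= _).
  by case: (n %/ q) => // k; rewrite leq_exp2r.
by rewrite -expnM leq_exp2l // mulnC leq_divM.
Qed.

(* Let e be the order of x mod q, q^a the q-part of x^e - 1 and k = n / e.    *)
(* Lifting the exponent turns the left-hand side into q^(ak) * (k!)_q; here   *)
(* (k!)_q <= 2^k, while 2 * q^a < x^e because x^e - 1 is even.                *)
Lemma part_prod_exp_sub1_lt q x n :
    prime q -> odd q -> odd x -> 1 < x -> coprime x q -> 0 < n ->
  q ^ logn q (\prod_(1 <= i < n.+1) (x ^ i - 1)) < x ^ n.
Proof.
move=> q_pr q_odd x_odd x_gt1 co_xq n_gt0; have q_gt0 := prime_gt0 q_pr.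
have exP : exists e, (0 < e) && (x ^ e == 1 %[mod q]).
  by exists (totient q); rewrite totient_gt0 q_gt0; apply/eqP/Euler_exp_totient.
case: (ex_minnP exP) => e /andP[e_gt0 /eqP xe1] e_min.
set y := x ^ e in xe1.
have y_gt1 : 1 < y by rewrite -[1](exp1n e) ltn_exp2r.
have e_dvd i : (q %| x ^ i - 1) = (e %| i).
  rewrite -eqn_mod_dvd ?expn_gt0 1?ltnW //.
  rewrite {1}(divn_eq i e) expnD [i %/ e * e]mulnC expnM -/y.
  rewrite -modnMml -modnXm xe1 modnXm exp1n modnMml mul1n.
  rewrite /dvdn; case: (posnP (i %% e)) => [-> | r_gt0]; first by rewrite !eqxx.
  apply/negP=> xr; have := e_min (i %% e); rewrite r_gt0 xr => /(_ isT).
  by rewrite leqNgt ltn_mod e_gt0.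
have logE k : logn q (\prod_(1 <= i < k.+1) (x ^ i - 1)) =
    k %/ e * logn q (y - 1) + logn q (k %/ e)`!.
  elim: k => [|k IHk]; first by rewrite big_nil div0n logn1.
  have pos i : 0 < x ^ i.+1 - 1 by rewrite subn_gt0 -[1](exp1n i.+1) ltn_exp2r.
  rewrite big_nat_recr //= lognM ?pos //; last first.
    by rewrite big_add1 big_mkord prodn_gt0.
  rewrite IHk divnS //.
  have [/dvdnP[j def_k] | e'k] := boolP (e %| k.+1); last first.
    by rewrite [logn q (x ^ _ - 1)]logn_ndvd ?add0n ?addn0 // e_dvd.
  have ke : k %/ e = j.-1.
    by have := divnS k e_gt0; rewrite def_k mulnK // dvdn_mull // => ->.
  case: j => [|j] in def_k ke *; first by [].
  rewrite ke def_k [j.+1 * e]mulnC expnM logn_exp_sub1 //= add1n factS.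
  by rewrite lognM ?fact_gt0 // -/y; lia.
rewrite logE expnD mulnC expnM.
set k := n %/ e.
have half : 2 * q ^ logn q (y - 1) < y.
  suff : 2 * q ^ logn q (y - 1) <= y - 1 by lia.
  apply: dvdn_leq; first by lia.
  rewrite Gauss_dvd ?coprime2n ?oddX ?q_odd ?orbT // pfactor_dvdnn andbT dvdn2.
  by rewrite oddB ?oddX ?x_odd ?orbT // ltnW.
(* If [n < e], the q-part is 1; the comparison of k-th powers below is strict only for [k > 0]. *)
have [k0 | k_gt0] := posnP k.
  by rewrite k0 fact0 logn1 !expn0 exp1n muln1 -[ltnLHS](exp1n n) ltn_exp2r.
have lek : y ^ k <= x ^ n by rewrite -expnM leq_exp2l // mulnC leq_divM.
apply: leq_trans lek.
have le2 := part_fact_le_exp2 k q_pr q_odd.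
rewrite expnAC; apply: leq_ltn_trans (_ : 2 ^ k * (q ^ logn q (y - 1)) ^ k < _).
  by rewrite leq_mul2r le2 orbT.
by rewrite -expnMn ltn_exp2r.
Qed.

(** * Chief factors of a perfect semidirect product *)

Import GroupScope.

Lemma faithful_abelem_dvd_GL (p : nat) (gT : finGroupType) (E G : {group gT}) :
    p.-abelem E -> E :!=: 1 -> G \subset 'N(E) -> 'C_G(E) = 1 ->
  #|G| %| #|'GL_(logn p #|E|)['F_p]|.
Proof.
move=> abelE ntE nEG cEG1.
rewrite -(dim_abelemE abelE ntE).
have ffulG := abelem_mx_faithful abelE ntE nEG cEG1.
have injf : 'injm (reprGLm (abelem_repr abelE ntE nEG)).
  by rewrite ker_reprGLm.
by rewrite -(card_injm injf (subxx G)) cardSg // subsetT.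
Qed.

Lemma perfect_sol_trivg (gT : finGroupType) (G : {group gT}) :
  G^`(1) = G -> solvable G -> G :=: 1.
Proof.
move=> perfG solG; apply: contraTeq isT => ntG.
by have := sol_der1_proper solG (subxx G) ntG; rewrite perfG properxx.
Qed.

(** [G] vanishes in [X / K], which is thus an image of [N]: perfect and solvable, hence trivial. *)
Lemma perfect_mul_sol_sub (gT : finGroupType) (X N G K : {group gT}) :
    X^`(1) = X -> N * G = X -> solvable N -> K <| X -> G \subset K ->
  X \subset K.
Proof.
move=> perfX defX solN /andP[sKX nKX] sGK.
have nKN : N \subset 'N(K) by rewrite (subset_trans _ nKX) // -defX mulG_subl.
have defXK : X / K = N / K.
  by rewrite -defX quotientMl // (quotientS1 sGK) mulg1.
rewrite -quotient_sub1 //; apply/trivgP.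
apply: (@perfect_sol_trivg _ (X / K)); first by rewrite -quotient_der ?perfX.
by rewrite /= defXK quotient_sol.
Qed.

(** Induction on |N| through a minimal normal subgroup [L] of [X] inside [N]. If [r] divides |N /
    L|, pass to [X / L]. Otherwise [L] is an elementary abelian r-group on which the simple group
    [G] acts faithfully or trivially, and perfection of [X] excludes the latter. *)
Lemma perfect_sdprod_dvd_GL (r : nat) (gT : finGroupType)
    (X N G : {group gT}) :
    N ><| G = X -> X^`(1) = X -> solvable N -> simple G ->
    prime r -> r %| #|N| ->
  exists n, [/\ 0 < n, r ^ n %| #|N| & #|G| %| #|'GL_n['F_r]|].
Proof.
have [m] := ubnP #|N|; elim: m gT X N G => // m IHm gT X N G ltNm.
move=> defX perfX solN simG r_pr rN.
have [nsNX sGX defNG nNG tiNG] := sdprod_context defX.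
have [sNX nNX] := andP nsNX.
have ntN : N :!=: 1.
  by apply: contraTneq rN => ->; rewrite cards1 dvdn1 neq_ltn prime_gt1 ?orbT.
have [L minL sLN] := minnormal_exists ntN nNX.
have [nLX ntL /is_abelemP[s s_pr abelL]] := minnormal_solvable minL sLN solN.
have nLN := subset_trans sNX nLX; have nLG := subset_trans sGX nLX.
have tiLG : L :&: G = 1 by apply/trivgP; rewrite -tiNG setSI.
have [rNL | rN'L] := boolP (r %| #|N / L|).
  have isoG := quotient_isog nLG tiLG.
  have [||||||//|n [n_gt0 rnN dvG]] := IHm _ (X / L)%G (N / L)%G (G / L)%G.
  - by apply: leq_trans (ltn_quotient ntL sLN) ltNm.
  - by rewrite sdprodE ?quotient_norms -?quotientMl ?defNG //= -quotientGI
               // tiNG quotient1.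
  - by rewrite -quotient_der ?perfX.
  - exact: quotient_sol.
  - by rewrite -(isog_simple isoG).
  - by [].
  exists n; split=> //; last by rewrite (card_isog isoG).
  by apply: dvdn_trans rnN _; rewrite dvdn_quotient.
have pL := abelem_pgroup abelL.
have r_eq_s : r = s.
  have: r %| #|L|.
    move: rN; rewrite -(Lagrange sLN) -card_quotient // Euclid_dvdM //.
    by rewrite (negPf rN'L) orbF.
  have [k ->] := p_natP pL.
  by rewrite Euclid_dvdX // dvdn_prime2 // => /andP[/eqP].
rewrite -{s}r_eq_s in s_pr abelL pL.
have oL : #|L| = (r ^ logn r #|L|)%N by apply: card_pgroup.
have [cGL1 | cGL] : 'C_G(L) = 1 \/ G \subset 'C(L).
  have [_ simG'] := simpleP _ simG.
  have nsCG : 'C_G(L) <| G by rewrite norm_normalI // norms_cent.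
  case: (simG' 'C_G(L)%G nsCG) => [|defC]; first by left.
  by right; rewrite -[gval G]defC subsetIr.
  exists (logn r #|L|); split; last exact: faithful_abelem_dvd_GL.
    have [_ rL _] := pgroup_pdiv pL ntL.
    by rewrite logn_gt0 mem_primes r_pr cardG_gt0.
  by rewrite -oL cardSg.
(* Now L is a central Sylow r-subgroup of N, hence has a complement R that is *)
(* characteristic in N, and X = L (RG) with L abelian and X perfect.          *)
have nsCX : 'C_X(L) <| X by rewrite norm_normalI // norms_cent.
have cXL : X \subset 'C(L).
  have: X \subset 'C_X(L).
    by apply: (perfect_mul_sol_sub perfX defNG solN nsCX); rewrite subsetI sGX.
  by rewrite subsetI subxx.
have r'NL : r^'.-nat #|N : L| by rewrite -card_quotient // p'natE.
have sylL : Hall N L.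
  apply: (@pHall_Hall _ r).
  by rewrite /pHall sLN pL r'NL.
have nsLN : L <| N by apply/andP.
have /splitsP[R /complP[tiLR defLR]] := SchurZassenhaus_split sylL nsLN.
have sRN : R \subset N by rewrite -defLR mulG_subr.
have cLR : R \subset 'C(L) := subset_trans (subset_trans sRN sNX) cXL.
have nsRN : R <| N.
  rewrite /normal sRN -defLR mul_subG ?normG // cents_norm // centsC //.
have hallR : r^'.-Hall(N) R.
  have oN : (#|L| * #|R|)%N = #|N| by rewrite -(TI_cardMg tiLR) defLR.
  have oR : #|R| = #|N : L|.
    by apply/eqP; rewrite -(eqn_pmul2l (cardG_gt0 L)) oN Lagrange.
  rewrite /pHall sRN /pgroup oR r'NL pnatNK.
  by rewrite -divgS // -oN mulnK // [_.-nat _]pL.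
have nRX : X \subset 'N(R).
  rewrite -(normal_Hall_pcore hallR nsRN).
  by rewrite (char_norm_trans (pcore_char _ _)).
have nRG := subset_trans sGX nRX.
have defX' : L * (R <*> G) = X.
  by rewrite norm_joinEr // mulgA defLR.
have cLG : L \subset 'C(R <*> G).
  by rewrite centsC join_subG cLR cGL.
(* The quotient of [X] by [R <*> G] is an image of the abelian group [L], and [X] is perfect. *)
have sXRG : X \subset R <*> G.
  have nK : X \subset 'N(R <*> G).
    by rewrite -defX' mul_subG ?normG // cents_norm.
  rewrite -{1}perfX der1_min // -defX' quotientMidr quotient_abelian //.
  exact: abelem_abelian abelL.
(* Dedekind's modular law: N lies in R(G :&: N) = R. *)
have sNR : N \subset R.
  rewrite -(mulg1 R) -tiNG setIC group_modl // -norm_joinEr // subsetI subxx.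
  by rewrite (subset_trans sNX).
by case/eqP: ntL; rewrite -tiLR (setIidPl (subset_trans sLN sNR)).
Qed.

(** * Comparison of the orders of the two factors *)

(** Since [q] is prime to [p], [q ^ m] divides the factor of |GL_n(p)| that is the product of the
    p^i - 1, whose q-part is below [p ^ n]. *)
Lemma prime_power_dvd_GL_lt p q m n :
    prime p -> prime q -> odd p -> odd q -> p != q -> 0 < n ->
  q ^ m %| #|'GL_n['F_p]| -> (q ^ m < p ^ n)%N.
Proof.
move=> p_pr q_pr p_odd q_odd p'q n_gt0.
have co_pq : coprime p q by rewrite prime_coprime // dvdn_prime2.
rewrite card_GL // card_Fp // Gauss_dvdr; last first.
  by rewrite coprimeXl // coprimeXr // coprime_sym.
have p_gt1 := prime_gt1 p_pr; move=> dv.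
apply: leq_ltn_trans (part_prod_exp_sub1_lt q_pr q_odd p_odd p_gt1 co_pq n_gt0).
rewrite leq_exp2l ?prime_gt1 // -pfactor_dvdn //.
rewrite big_add1 big_mkord prodn_gt0 // => i.
by rewrite subn_gt0 -[ltnLHS](exp1n i.+1) ltn_exp2r.
Qed.

Lemma nonsolvable_odd_primes (gT : finGroupType) (G : {group gT}) :
  ~~ solvable G ->
  exists p q, [/\ prime p, prime q, odd p, odd q & p != q] /\
    (p %| #|G|) && (q %| #|G|).
Proof.
move=> nsolG; set s := rem 2 (primes #|G|).
have s_gt1 : 1 < size s.
  have: 2 < size (primes #|G|).
    by rewrite ltnNge; apply: contra nsolG; apply: Burnside_p_a_q_b.
  rewrite /s; have [s2 | /rem_id->] := boolP (2 \in primes #|G|);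
    last exact: ltnW.
  by rewrite size_rem //; case: size.
have s_uniq : uniq s by rewrite rem_uniq ?primes_uniq.
have sP r : r \in s -> [/\ prime r, odd r & r %| #|G|].
  rewrite mem_rem_uniq ?primes_uniq // !inE mem_primes => /and4P[r'2 r_pr _ rG].
  by split=> //; case/even_prime: r_pr r'2 => [->|].
case: s s_gt1 s_uniq sP => [|p [|q s]] // _ /andP[p's _] sP.
have [|p_pr p_odd pG] := sP p; first exact: mem_head.
have [|q_pr q_odd qG] := sP q; first by rewrite !inE eqxx orbT.
exists p, q; split; last by rewrite pG.
split=> //.
by apply: contraNneq p's => ->; apply: mem_head.
Qed.

Lemma perfect_sdprod_card_neq (gT : finGroupType) (X N G : {group gT}) :
    N ><| G = X -> X^`(1) = X -> solvable N -> simple G ->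
  #|N| <> #|G|.
Proof.
move=> defX perfX solN simG oNG.
have [nsNX sGX defNG nNG tiNG] := sdprod_context defX.
(* A solvable [G] would make the perfect group [X] solvable, hence trivial. *)
have nsolG : ~~ solvable G.
  have [ntG _] := simpleP _ simG; apply: contra ntG => solG.
  have solX : solvable X.
    rewrite (series_sol nsNX) solN -defNG quotientMidl.
    exact: quotient_sol.
  by rewrite -subG1 -(perfect_sol_trivg perfX solX).
have [p [q [[p_pr q_pr p_odd q_odd p'q]]]] := nonsolvable_odd_primes nsolG.
rewrite -oNG => /andP[pN qN].
have [n [n_gt0 pn dvp]] := perfect_sdprod_dvd_GL defX perfX solN simG p_pr pN.
have [m [m_gt0 qm dvq]] := perfect_sdprod_dvd_GL defX perfX solN simG q_pr qN.
rewrite oNG in pn qm.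
have ltqp : (q ^ m < p ^ n)%N.
  exact: prime_power_dvd_GL_lt (dvdn_trans qm dvp).
have: (p ^ n < q ^ m)%N.
  by apply: prime_power_dvd_GL_lt (dvdn_trans pn dvq); rewrite // eq_sym.
by rewrite ltnNge ltnW.
Qed.

Lemma nonsolvable_simple_perfect (gT : finGroupType) (G : {group gT}) :
  simple G -> ~~ solvable G -> G^`(1) = G.
Proof.
move=> simG nsolG; have [_ simG'] := simpleP _ simG.
case: (simG' G^`(1)%G (der_normal 1 G)) => // G'1; case/negP: nsolG.
by rewrite abelian_sol // /abelian (sameP commG1P eqP) -derg1 [G^`(1)]G'1.
Qed.

Lemma perfect_morphim (aT rT : finGroupType) (D K : {group aT})
    (f : {morphism D >-> rT}) :
  K \subset D -> K^`(1) = K -> (f @* K)^`(1) = f @* K.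
Proof. by move=> sKD perfK; rewrite -morphim_der // perfK. Qed.

(** * Translations and the lambda action of a skew brace *)

Section RegularActions.

Variables (T : finType) (A : skew_brace T).
Local Notation V := (addG A).
Local Notation M := (mulG A).

(** In additive notation, -a + ax. The brace law amounts to additivity of [lambda a]; with
    associativity of the product it makes lambda an action. *)
Definition lambda (a : M) (x : V) : V := (a : V)^-1 * sb_mul A a x.

Lemma lambdaM (a : M) (x y : V) : lambda a (x * y) = lambda a x * lambda a y.
Proof.
have brace : sb_mul A a (x * y) =
    (sb_mul A a x : V) * (a : V)^-1 * (sb_mul A a y : V) := sb_brace A a x y.
by rewrite /lambda brace !mulgA.
Qed.

Lemma lambda_at1 (a : M) : lambda a 1 = 1.
Proof. by apply: (mulgI (lambda a 1)); rewrite -lambdaM !mulg1. Qed.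

Lemma lambdaV (a : M) (x : V) : lambda a x^-1 = (lambda a x)^-1.
Proof.
by apply/eqP; rewrite eq_sym eq_invg_mul -lambdaM mulgV lambda_at1.
Qed.

Lemma lambda_mulG (a b : M) (x : V) : lambda (a * b) x = lambda a (lambda b x).
Proof.
rewrite [lambda b x]/lambda lambdaM lambdaV.
rewrite /lambda invMg invgK -mulgA mulKVg.
by congr (_ * _); rewrite -(sb_mulA A).
Qed.

Lemma lambda_inj (a : M) : injective (lambda a).
Proof.
by move=> x y /mulgI eqxy; apply: (mulgI (a : M)).
Qed.

(* MathComp permutations compose from left to right: the inverses make these *)
(* maps homomorphisms.                                                       *)
Definition add_perm (b : V) : {perm V} := perm (mulgI b^-1).

Definition mul_perm (a : M) : {perm V} := perm (@mulgI M (a^-1 : M)).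

Definition lambda_perm (a : M) : {perm V} := perm (@lambda_inj a^-1).

Lemma add_permM : {in [set: V] &, {morph add_perm : b c / b * c}}.
Proof.
by move=> b c _ _; apply/permP=> x; rewrite permM !permE invMg mulgA.
Qed.

Lemma mul_permM : {in [set: M] &, {morph mul_perm : a b / a * b}}.
Proof.
move=> a b _ _; apply/permP=> x; rewrite permM !permE invMg.
exact/esym/(mulgA (b^-1 : M)).
Qed.

Lemma lambda_permM : {in [set: M] &, {morph lambda_perm : a b / a * b}}.
Proof.
by move=> a b _ _; apply/permP=> x; rewrite permM !permE invMg lambda_mulG.
Qed.

Canonical add_perm_morphism := Morphism add_permM.
Canonical mul_perm_morphism := Morphism mul_permM.
Canonical lambda_perm_morphism := Morphism lambda_permM.

(** Multiplicative translations are affine: a^-1 x is the sum of a^-1 and lambda_(a^-1)(x). This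
    puts H in NG, and N in the group generated by G and H. *)
Lemma mul_permE (a : M) :
  mul_perm a = lambda_perm a * add_perm ((a^-1 : M) : V)^-1.
Proof. by apply/permP=> x; rewrite permM !permE invgK mulKVg. Qed.

Lemma add_permJ (b : V) (a : M) :
  add_perm b ^ lambda_perm a = add_perm (lambda_perm a b).
Proof.
apply: (mulgI (lambda_perm a)); rewrite -conjgC.
by apply/permP=> x; rewrite !permM !permE lambdaM lambdaV.
Qed.

Lemma injm_add_perm : 'injm add_perm.
Proof.
by apply/injmP=> b c _ _ /permP/(_ 1); rewrite !permE !mulg1; apply: invg_inj.
Qed.

Lemma mulG_not_simple :
  solvable [set: V] -> ~~ solvable [set: M] -> ~~ simple [set: M].
Proof.
move=> solV nsolM; apply/negP=> simM.
have perfM := nonsolvable_simple_perfect simM nsolM.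
set N := (add_perm @* setT)%G; set G := (lambda_perm @* setT)%G.
set H := (mul_perm @* setT)%G.
have nNG : G \subset 'N(N).
  apply/subsetP=> _ /morphimP[a _ _ ->]; rewrite inE.
  apply/subsetP=> _ /imsetP[_ /morphimP[b _ _ ->] ->].
  by rewrite /= add_permJ mem_morphim ?inE.
have tiNG : N :&: G = 1.
  apply/trivgP/subsetP=> _ /setIP[/morphimP[b _ _ ->]].
  move=> /morphimP[a _ _ /= eq_ba].
  suff -> : b = 1 by rewrite /= morph1 inE.
  (* Evaluate at the additive neutral element, which lambda fixes and the translation sends to
     [b^-1]. *)
  move/permP/(_ 1): eq_ba; rewrite !permE mulg1 lambda_at1 => /eqP.
  by rewrite invg_eq1 => /eqP.
have defX : N ><| G = N <*> G by rewrite sdprodE // norm_joinEr.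
have sNX : N \subset N <*> G := joing_subl _ _.
have sGX : G \subset N <*> G := joing_subr _ _.
have sHX : H \subset N <*> G.
  apply/subsetP=> _ /morphimP[a _ _ ->].
  rewrite /= mul_permE groupM //.
    by rewrite (subsetP sGX) // mem_morphim ?inE.
  by rewrite (subsetP sNX) // mem_morphim ?inE.
have sGX' : G \subset (N <*> G)^`(1).
  have perfG : G^`(1) = G.
    exact: (perfect_morphim lambda_perm_morphism (subxx _) perfM).
  by rewrite -{1}perfG dergS.
have sHX' : H \subset (N <*> G)^`(1).
  have perfH : H^`(1) = H.
    exact: (perfect_morphim mul_perm_morphism (subxx _) perfM).
  by rewrite -{1}perfH dergS.
have sNX' : N \subset (N <*> G)^`(1).
  apply/subsetP=> _ /morphimP[b _ _ ->] /=.
  (* The multiplicative inverse of [a] is the additive inverse of [b], so [mul_permE] can be solved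
     for [add_perm b]. *)
  pose a : M := ((b^-1 : V) : M)^-1.
  have -> : add_perm b = (lambda_perm a)^-1 * mul_perm a.
    by rewrite mul_permE mulKg invgK invgK.
  rewrite groupM ?groupV //.
    by rewrite (subsetP sGX') // mem_morphim ?inE.
  by rewrite (subsetP sHX') // mem_morphim ?inE.
have perfX : (N <*> G)^`(1) = N <*> G.
  by apply/eqP; rewrite eqEsubset der_sub join_subG sNX'.
have solN : solvable N by apply: morphim_sol.
have oV : #|[set: V]| = #|[set: M]|.
  rewrite !cardsT; apply: (@bij_eq_card V M id); exact: inv_bij.
have [ntM simM'] := simpleP _ simM.
have oN : #|N| = #|[set: V]| by rewrite card_injm ?injm_add_perm.
have [ker1 | kerM] := simM' ('ker lambda_perm)%G (ker_normal _).
  have injl : 'injm lambda_perm by rewrite ker1.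
  have isoG : [set: M] \isog G by apply: (sub_isog (subxx _) injl).
  have simG : simple G by rewrite -(isog_simple isoG).
  apply: (perfect_sdprod_card_neq defX perfX solN simG).
  by rewrite oN oV card_injm.
have G1 : G :=: 1 by have := morphim_ker lambda_perm_morphism; rewrite kerM.
have defXN : N <*> G = N by rewrite G1 joingG1.
have N1 : N :=: 1.
  by apply: perfect_sol_trivg => //; rewrite -{1}defXN perfX defXN.
case/eqP: ntM; apply/eqP; rewrite trivg_card1 -oV -oN.
by rewrite N1 cards1.
Qed.

End RegularActions.

Theorem theorem3p1 (T : finType) (A : skew_brace T)
    (minA : minimal_add_solvable_mul_nonsolvable A) :
  ~~ simple [set: mulG A].
Proof. by have [solA nsolA _] := minA; apply: mulG_not_simple. Qed.
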